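(* Let $T\subseteq[0,1]$ with $\{0,1\}\subseteq T$, and let $0\le R\le1$. Suppose that $a,b\colon T\to[0,R]$ are functions such that $a(0)=b(0)=0$, $a(1)=b(1)=R$, and $a(t)\le b(t)$ for every $t\in T$. Assume further that $a$ and $b$ are nondecreasing and $1$-Lipschitz, that is, $0\le a(t)-a(s)\le t-s$ and $0\le b(t)-b(s)\le t-s$ for all $s,t\in T$ with $s\le t$. If the set $$\mathcal B_T(a,b)=\{B\subseteq[0,1]\text{ Borel}\mid a(t)\le\lambda(B\cap[0,t])\le b(t)\text{ for every }t\in T\}$$ is nonempty, then it is the family of bases of a measurable matroid on $[0,1]$ (equipped with its Borel $\sigma$-algebra and Lebesgue measure $\lambda$).
   Context: Convention: on a measure space $(J,\Sigma,\mu)$ measurable sets are identified when they differ by a $\mu$-null set: $A=B$ means $\mu(A\triangle B)=0$, $A\subseteq B$ means $\mu(A\setminus B)=0$, and families of measurable sets are families in the measure algebra (membership is unaffected by null modifications). A set $X$ in a family $\mathcal X$ is maximal in $\mathcal X$ if $X\subseteq Y\in\mathcal X$ implies $Y\subseteq X$. Write $\mathcal X|Z=\{X\in\mathcal X\mid X\subseteq Z\}$. A measurable matroid $(J,\Sigma,\mu,\mathcal F)$ consists of a standard Borel space $(J,\Sigma)$ with a finite atomless measure $\mu$ and a family $\mathcal F\subseteq\Sigma$ (the independent sets) satisfying: (I1) $\emptyset\in\mathcal F$; (I2) $F_1\subseteq F_2\in\mathcal F$ implies $F_1\in\mathcal F$; (I3) for all $X\in\Sigma$ and all maximal $F_1,F_2\in\mathcal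 F|X$, $\mu(F_1)=\mu(F_2)$; (I4) if $(F_i)_{i\in\mathbb N}$ is an increasing sequence in $\mathcal F$, then $\bigcup_i F_i\in\mathcal F$. Its bases are the maximal members of $\mathcal F$. Here $(J,\Sigma,\mu)=([0,1],\text{Borel},\lambda)$ with $\lambda$ Lebesgue measure. *)

(* Defs.v *)
From HB Require Import structures.
From mathcomp Require Import all_boot all_order all_algebra.
From mathcomp Require Import all_classical all_reals all_analysis.
From mathcomp Require Import metric_structure.

Set Implicit Arguments.
Unset Strict Implicit.
Unset Printing Implicit Defensive.

Import Order.TTheory GRing.Theory Num.Theory.
Import numFieldNormedType.Exports.

Local Open Scope classical_set_scope.
Local Open Scope ring_scope.

Definition polish (R : realType) (P : metricType R) : Prop :=
  (exists2 D : set P, countable D & dense D) /\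
  (forall G : set_system P, ProperFilter G -> cauchy G -> exists p : P, G --> p).

Definition standard_borel (R : realType) d (J : measurableType d) : Prop :=
  exists (P : metricType R) (f : J -> P),
    [/\ polish P, bijective f &
        forall A : set J, measurable A <-> <<s @open P >> (f @` A)].

Section measurable_matroid.
Local Open Scope ereal_scope.
Context d (J : measurableType d) (R : realType).
Variable mu : {measure set J -> \bar R}.
Implicit Types (A B X Z : set J) (F : set (set J)).

Definition atomless : Prop :=
  forall A, measurable A -> 0 < mu A ->
    exists B, [/\ measurable B, B `<=` A, 0 < mu B & mu B < mu A].

Definition ae_subset A B : Prop := mu (A `\` B) = 0.

(* A family of members of the measure algebra, encoded as the set of all
   measurable representatives of its members. *)
Definition measure_algebra_family F : Prop :=
  F `<=` measurable /\
  (forall A B, F A -> measurable B -> mu (A `+` B) = 0 -> F B).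

Definition maximal_sets F : set (set J) :=
  [set A | F A /\ forall B, F B -> ae_subset A B -> ae_subset B A].

Definition family_below F Z : set (set J) := [set A | F A /\ ae_subset A Z].

Record measurable_matroid F : Prop := MeasurableMatroid {
  matroid_standard_borel : standard_borel R J;
  matroid_finite : mu setT < +oo;
  matroid_atomless : atomless;
  matroid_family : measure_algebra_family F;
  matroid_I1 : F set0;
  matroid_I2 : forall A B,
    measurable A -> ae_subset A B -> F B -> F A;
  matroid_I3 : forall X, measurable X -> forall A B,
    maximal_sets (family_below F X) A ->
    maximal_sets (family_below F X) B -> mu A = mu B;
  matroid_I4 : forall E : (set J)^nat,
    (forall n, F (E n)) -> (forall n, ae_subset (E n) (E n.+1)) ->
    F (\bigcup_n E n) }.

Definition bases F : set (set J) := maximal_sets F.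

End measurable_matroid.

Section unit_interval.
Context (R : realType).

Definition unit_interval_set : set R := `[0, 1].

Fact zero_in_unit : (0 : R) \in unit_interval_set.
Proof. by rewrite inE /unit_interval_set /= in_itv /= lexx ler01. Qed.

HB.instance Definition _ :=
  isPointed.Build (set_type unit_interval_set) (exist _ 0 zero_in_unit).

(* [0, 1] with the trace of the Borel sigma-algebra of R. *)
Definition unit_interval : Type :=
  g_sigma_algebra_preimageType
    (set_val : set_type unit_interval_set -> measurableTypeR R).

HB.instance Definition _ := Measurable.on unit_interval.

Definition unit_val (x : unit_interval) : R := set_val x.

Lemma unit_val_inj : injective unit_val.
Proof. exact: val_inj. Qed.

Lemma measurable_unit_image (A : set unit_interval) :
  measurable A -> measurable (unit_val @` A : set (measurableTypeR R)).
Proof.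
case=> B mB <-; rewrite setTI.
suff -> : unit_val @` (set_val @^-1` B) = B `&` unit_interval_set.
  apply: measurableI => //; rewrite /unit_interval_set; exact: measurable_itv.
apply/seteqP; split=> [_ [x Bx <-]|x [Bx Ix]].
  split=> //; exact: set_valP.
by exists (exist _ x (mem_set Ix)).
Qed.

Definition unit_lebesgue (A : set unit_interval) : \bar R :=
  lebesgue_measure (unit_val @` A).

Fact unit_lebesgue0 : unit_lebesgue set0 = 0%E.
Proof. by rewrite /unit_lebesgue image_set0 measure0. Qed.

Fact unit_lebesgue_ge0 A : (0 <= unit_lebesgue A)%E.
Proof. exact: measure_ge0. Qed.

Fact unit_lebesgue_sigma : semi_sigma_additive unit_lebesgue.
Proof.
move=> A mA tA mUA; rewrite /unit_lebesgue image_bigcup.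
apply: measure_semi_sigma_additive.
- by move=> i; exact: measurable_unit_image.
- apply/trivIsetP => i j _ _ ij; move/trivIsetP: tA => /(_ i j Logic.I Logic.I ij).
  rewrite -!subset0 => tA x [[y Ay <-] [z Az /unit_val_inj zy]].
  by apply: (tA y); split=> //; rewrite -zy.
- by rewrite -image_bigcup; exact: measurable_unit_image.
Qed.

HB.instance Definition _ := isMeasure.Build _ _ _
  unit_lebesgue unit_lebesgue0 unit_lebesgue_ge0 unit_lebesgue_sigma.

(* [a] and [b] matter only on [T], so they are taken to be total. *)
Definition bounded_profile_family (T : set R) (a b : R -> R) :
    set (set unit_interval) :=
  [set B | measurable B /\ forall t, T t ->
    ((a t)%:E <= unit_lebesgue (B `&` [set x | (unit_val x <= t)%R]) <=
     (b t)%:E)%E].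

End unit_interval.

(* Main.v *)
Require Import Defs.
From HB Require Import structures.
From mathcomp Require Import all_boot all_order all_algebra.
From mathcomp Require Import all_classical all_reals all_analysis.
From mathcomp Require Import metric_structure measurable_realfun ring lra.

Import Order.TTheory GRing.Theory Num.Theory.
Import numFieldNormedType.Exports.

(** Write f_B(t) for the length of B `&` [0, t].  A subset A of a member of the
    family is bound to satisfy f_A(t) - f_A(s) <= b(t) - a(s) for all s <= t in
    T, and the point of the proof is that nothing else is required: the sets A
    with this property ([independent]) are the independent sets, and the
    members of the family ([base] below) are their bases.  In this form heredity
    and stability under increasing unions are immediate; what remains rests on
    one exchange statement, [base_extension]: if A is independent and B is a
    base, some base B' satisfies A `<=` B' `<=` A `|` B up to a null set.  It
    gives the bases at once, and it gives the rank axiom: if A1 and A2 are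
    maximal among the independent sets inside X, extend A2 to a base B2, then A1
    to a base B1 `<=` A1 `|` B2.  By maximality B1 `&` X is A1, so B1 `\` X lies
    in B2 `\` X; as all bases have the same length, A2 is not longer than A1
    ([maximal_independent_mass_le]).

    To prove [base_extension], move B towards A: enlarge A `&` B and shrink
    B `\` A at the same time.  A monotone sequence of such moves converges to
    a base, so an exhaustion argument ([exhaustion]) yields a base B at which no
    further gain is possible ([stuck]).  Suppose that A `\` B has positive
    length and let x be a density point of it.  Moving a small piece of B from a
    place y > x to x raises f_B between x and y and nowhere else, so it is
    allowed unless b - f_B gets arbitrarily small on T near some point of
    [x, y]; hence B `\` A is null between x and the first point v >= x
    where f_B touches b.  Symmetrically B `\` A is null between x and the last
    point w <= x where f_B touches a.  Between w and v the set B grows by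
    b(v) - a(w) (in the limit sense), so A cannot grow more
    ([tight_increment]); as A contains A `\` B and all of B there, w < v is
    impossible.  Thus w = x = v, and f_B touches both a and b at every density
    point of A `\` B ([full_point_tight]).  Now [tight_increment] applies
    between any two density points s < t and says that A `\` B is not longer
    than B `\` A on ]s, t], so that it fills at most half of ]s, t].  Near a
    density point this is absurd ([stuck_ae_subset]).

    Touching is defined by approximation ([tight]) because T need not be
    closed and a, b live on T only. *)

Set Implicit Arguments.
Unset Strict Implicit.
Unset Printing Implicit Defensive.

Local Open Scope classical_set_scope.
Local Open Scope ring_scope.

(** * The unit interval is standard Borel *)

(** A separate name for the carrier, so that it can receive the distance
    inherited from the line without meeting the structures already attached to
    the subtype. *)
Definition metric_interval (R : realType) : Type := set_type (@unit_interval_set R).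

HB.instance Definition _ (R : realType) :=
  Choice.copy (metric_interval R) (set_type (@unit_interval_set R)).

Section metric_interval.
Context {R : realType}.
Implicit Types x y z : metric_interval R.

Definition metric_val x : R := set_val x.

Let dist x y : R := `|metric_val x - metric_val y|.

Let distxx x : dist x x = 0. Proof. by rewrite /dist subrr normr0. Qed.

Let dist_eq0 x y : dist x y = 0 -> x = y.
Proof. by move/normr0_eq0/subr0_eq/val_inj. Qed.

Let dist_sym x y : dist x y = dist y x. Proof. exact: distrC. Qed.

Let dist_triangle y x z : dist x z <= dist x y + dist y z.
Proof. exact: ler_distD. Qed.

HB.instance Definition _ := isMetric.Build R (metric_interval R)
  distxx dist_eq0 dist_sym dist_triangle.

Lemma metric_interval_ball x e y :
  ball x e y <-> `|metric_val x - metric_val y| < e.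
Proof. by []. Qed.

(** The topology of the restricted distance is the subspace topology; together
    with the commutation of preimages with generated sigma-algebras, this is
    what identifies the trace of the Borel sets with the Borel sets of the
    subspace. *)
Lemma metric_interval_open :
  @open (metric_interval R) = preimage_set_system setT metric_val open.
Proof.
apply/seteqP; split => [U oU|_ [V oV <-]]; last first.
  rewrite setTI openE => x /= Vx.
  move: oV; rewrite openE => /(_ _ Vx).
  rewrite /interior -nbhs_ballE => -[e e0 eV]; rewrite -nbhs_ballE; exists e => //.
  by move=> y /metric_interval_ball xy; apply: eV.
exists (\bigcup_(q in [set q : metric_interval R * R |
    ball q.1 q.2 `<=` U]) ball (metric_val q.1) q.2).
  by apply: bigcup_open => q _; exact: ball_open.
rewrite setTI; apply/seteqP; split => [x [[y e] /= yeU] yx|x Ux].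
  by apply: yeU.
move: oU; rewrite openE => /(_ _ Ux).
rewrite /interior -nbhs_ballE => -[e e0 eU].
by exists (x, e) => //=; exact: ballxx.
Qed.

End metric_interval.

Lemma metric_interval_polish (R : realType) : polish (metric_interval R).
Proof.
split.
  exists (metric_val @^-1` (range ratr)).
    have /inj_card_eq/card_eqPle[_ /sub_countable] :
        {in metric_val @^-1` (range ratr) &, injective (@metric_val R)}.
      by move=> x y _ _; exact: val_inj.
    apply; apply: (@sub_countable _ _ _ (range (@ratr R))).
      by apply: subset_card_le => _ [y + <-].
    exact: sub_countable (card_image_le _ _) (countableP _).
  move=> U [x Ux] oU.
  have [V oV] : preimage_set_system setT metric_val open U.
    by rewrite -metric_interval_open.
  rewrite setTI => VU.
  have Vx : V (metric_val x) by move: Ux; rewrite -VU.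
  have := set_valP x; rewrite /unit_interval_set /= in_itv /= -/(metric_val x).
  move=> /andP[x0 x1].
  have : (V `&` `]0, 1[) !=set0.
    have [e /= e0 eV] := (open_nbhs_nbhs (conj oV Vx)).
    pose d := Num.min e 1.
    have d0 : 0 < d by rewrite lt_min e0 ltr01.
    have [de d1] : d <= e /\ d <= 1 by rewrite /d; split; rewrite ge_min lexx ?orbT.
    have dx0 : 0 <= d * metric_val x by rewrite mulr_ge0// ltW.
    have dx1 : 0 <= d * (1 - metric_val x) by rewrite mulr_ge0 ?subr_ge0// ltW.
    have dx2 : 0 <= (1 - d) * metric_val x by rewrite mulr_ge0 ?subr_ge0.
    have dx3 : 0 <= (1 - d) * (1 - metric_val x) by rewrite mulr_ge0 ?subr_ge0.
    (* x may be an endpoint: push it towards 1/2 to enter the open interval,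
       where density of the rationals applies. *)
    exists (metric_val x * (1 - d) + d / 2); split.
      apply: eV => /=; rewrite ltr_norml; apply/andP; split; lra.
    rewrite /= in_itv /=; apply/andP; split; lra.
  move=> /dense_rat [|y [[Vq q01] [q _ qE]]].
    by apply: openI => //; exact: interval_open.
  rewrite -{}qE in Vq q01.
  have q01' : ratr q \in @unit_interval_set R.
    by rewrite inE /unit_interval_set/=; exact: subset_itv_oo_cc.
  exists (exist _ (ratr q) q01'); split; last by exists q.
  by rewrite -VU.
move=> G GF cG.
have : cauchy (metric_val @ G).
  apply/cauchyP => e e0.
  move/cauchyP : cG => /(_ e e0) [x Gx].
  by exists (metric_val x).
move=> /R_complete /cvg_ex [l Gl].
have l01 : l \in @unit_interval_set R.
  rewrite inE; apply: (@closed_cvg _ _ G _ metric_val (@unit_interval_set R)) Gl.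
    exact: itv_closed.
  by apply: nearW => x; exact: set_valP.
exists (exist _ l l01); apply/fcvg_ballP => e e0.
by move/cvg_ballP : Gl => /(_ e e0).
Qed.

Lemma borel_open (R : realType) (A : set R) :
  measurable (A : set (measurableTypeR R)) <-> <<s @open R >> A.
Proof.
split; last first.
  apply: smallest_sub; first exact: sigma_algebra_measurable.
  by move=> U oU; exact: open_measurable.
rewrite RGenOpens.measurableE; apply: smallest_sub => //.
by move=> _ [x [y ->]]; apply: sub_sigma_algebra; exact: interval_open.
Qed.

Lemma unit_interval_standard_borel (R : realType) :
  standard_borel R (unit_interval R).
Proof.
exists (metric_interval R), id; split; first exact: metric_interval_polish.
  by exists id.
move=> A; rewrite image_id metric_interval_open g_sigma_preimageE.
split => -[B mB <-]; exists B => //; exact/borel_open.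
Qed.

(** * Real-valued calculus of a finite measure *)

Section mass.
Context d (J : measurableType d) (R : realType).
Variable mu : {finite_measure set J -> \bar R}.
Implicit Types A B X : set J.

Definition mass A : R := fine (mu A).

Lemma massE A : measurable A -> mu A = (mass A)%:E.
Proof. by move=> mA; rewrite fineK// fin_num_measure. Qed.

Lemma mass0 : mass set0 = 0.
Proof. by rewrite /mass measure0. Qed.

Lemma mass_ge0 A : 0 <= mass A.
Proof. exact: fine_ge0. Qed.

Lemma le_mass A B : measurable A -> measurable B -> A `<=` B -> mass A <= mass B.
Proof.
by move=> mA mB AB; rewrite -lee_fin -!massE// le_measure ?inE.
Qed.

Lemma massU A B : measurable A -> measurable B -> A `&` B = set0 ->
  mass (A `|` B) = mass A + mass B.
Proof.
move=> mA mB AB; apply: EFin_inj; rewrite EFinD -!massE//; last exact: measurableU.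
by rewrite measureU.
Qed.

Lemma mass_setID X A : measurable A -> measurable X ->
  mass A = mass (A `&` X) + mass (A `\` X).
Proof.
move=> mA mX; rewrite -massU ?setUIDK//; [exact: measurableI|exact: measurableD|].
by rewrite -subset0 => x [[_ ?] []].
Qed.

Lemma mass_ae_subset A B : measurable A -> measurable B ->
  ae_subset mu A B <-> mass (A `\` B) = 0.
Proof.
move=> mA mB; rewrite /ae_subset -[X in X = _]/(mu (A `\` B)) massE.
  by split => [[]|->].
exact: measurableD.
Qed.

Lemma le_mass_ae A B : measurable A -> measurable B -> ae_subset mu A B ->
  mass A <= mass B.
Proof.
move=> mA mB /mass_ae_subset AB; rewrite (mass_setID mA mB) AB// addr0.
by apply: le_mass => //; exact: measurableI.
Qed.

Lemma cvg_mass_bigcup (E : (set J)^nat) : (forall n, measurable (E n)) ->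
  (forall n, E n `<=` E n.+1) -> mass (E n) @[n --> \oo] --> mass (\bigcup_n E n).
Proof.
move=> mE ndE; have mU : measurable (\bigcup_n E n) by exact: bigcupT_measurable.
apply: fine_cvg; rewrite -massE//; apply: nondecreasing_cvg_mu => //.
by apply/nondecreasing_seqP => n; exact/subsetPset.
Qed.

Lemma cvg_mass_bigcap (E : (set J)^nat) : (forall n, measurable (E n)) ->
  (forall n, E n.+1 `<=` E n) -> mass (E n) @[n --> \oo] --> mass (\bigcap_n E n).
Proof.
move=> mE niE; have mU : measurable (\bigcap_n E n) by exact: bigcapT_measurable.
apply: fine_cvg; rewrite -massE//; apply: nonincreasing_cvg_mu => //.
  by rewrite -ge0_fin_numE// fin_num_measure.
by apply/nonincreasing_seqP => n; exact/subsetPset.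
Qed.

End mass.

Section ae_subset.
Context d (J : measurableType d) (R : realType).
Variable mu : {finite_measure set J -> \bar R}.
Implicit Types A B C X : set J.

Lemma subset_ae_subset A B : A `<=` B -> ae_subset mu A B.
Proof.
rewrite /ae_subset -setD_eq0 => ->; exact: measure0.
Qed.

Lemma ae_subset_trans A B C : measurable A -> measurable B -> measurable C ->
  ae_subset mu A B -> ae_subset mu B C -> ae_subset mu A C.
Proof.
move=> mA mB mC /(mass_ae_subset _ mA mB) AB /(mass_ae_subset _ mB mC) BC.
apply/mass_ae_subset => //; apply: le_anti; rewrite mass_ge0 andbT.
have mAB : measurable (A `\` B) by exact: measurableD.
have mBC : measurable (B `\` C) by exact: measurableD.
have mU : measurable ((A `\` B) `|` (B `\` C)) by exact: measurableU.
apply: (@le_trans _ _ (mass mu ((A `\` B) `|` (B `\` C)))).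
  apply: le_mass => //; first exact: measurableD.
  by move=> x [Ax Cx]; have [Bx|Bx] := pselect (B x); [right|left].
rewrite massU//; first by rewrite AB BC addr0.
by rewrite -subset0 => x [[_ ?] []].
Qed.

Lemma ae_subsetI A B X : measurable A -> measurable B -> measurable X ->
  ae_subset mu A B -> ae_subset mu A X -> ae_subset mu A (B `&` X).
Proof.
move=> mA mB mX AB AX.
have mBX : measurable (B `&` X) by exact: measurableI.
have mAB : measurable (A `&` B) by exact: measurableI.
apply: (@ae_subset_trans _ (A `&` B)) => //.
  by move: AB; rewrite /ae_subset setDIr setDv set0U.
rewrite /ae_subset setDIr [(_ `\` B)](_ : _ = set0); last first.
  by rewrite -subset0 => x [[]].
rewrite set0U; apply/(mass_ae_subset _ mAB mX); apply: le_anti.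
rewrite mass_ge0 andbT -((mass_ae_subset _ mA mX).1 AX).
by apply: le_mass; [exact: measurableD|exact: measurableD|move=> x [[]]].
Qed.

Lemma ae_subsetSI A B X : measurable A -> measurable B -> measurable X ->
  ae_subset mu A B -> ae_subset mu (A `&` X) (B `&` X).
Proof.
move=> mA mB mX AB.
have mAX : measurable (A `&` X) by exact: measurableI.
apply: ae_subsetI => //; last by apply: subset_ae_subset => x [].
by apply: (@ae_subset_trans _ A) => //; apply: subset_ae_subset => x [].
Qed.

End ae_subset.

(** * Countable exhaustion *)

(** Greedy choice replaces Zorn's lemma, which would require upper bounds for
    uncountable chains: each step realises at least half of the gain still
    available above the current point, so above the bound of the sequence no
    gain is left. *)
Lemma exhaustion (R : realType) (X : Type) (le : X -> X -> Prop) (phi : X -> R)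
    (M : R) (le_refl : forall x, le x x)
    (le_trans : forall x y z, le x y -> le y z -> le x z)
    (phi_mono : forall x y, le x y -> phi x <= phi y)
    (phi_bound : forall x, phi x <= M)
    (chain_bound : forall u : nat -> X, (forall n, le (u n) (u n.+1)) ->
      exists z, forall n, le (u n) z) (x0 : X) :
  exists x, le x0 x /\ forall y, le x y -> phi y = phi x.
Proof.
pose S x := sup [set phi y | y in le x].
have hS x : has_sup [set phi y | y in le x].
  by split; [exists (phi x), x|exists M => _ [y _ <-]].
have leS x y : le x y -> phi y <= S x.
  by move=> xy; apply: sup_upper_bound => //; exists y.
have step x : {y | le x y /\ (phi x + S x) / 2 <= phi y}.
  apply: cid; have [xS|Sx] := ltP (phi x) (S x).
    have e0 : 0 < (S x - phi x) / 2 by lra.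
    have [_ [y xy <-] Sy] := sup_adherent e0 (hS x).
    by exists y; split => //; rewrite -/(S x) in Sy; lra.
  by exists x; split => //; lra.
have [u [u0 uS]] := dependent_choice step x0.
have [z uz] := chain_bound u (fun n => (uS n).1).
exists z; split => [|y zy]; first by rewrite -u0.
apply/eqP; rewrite eq_le (phi_mono _ _ zy) andbT.
have gap n : phi y - phi z <= (phi y - phi x0) * 2^-1 ^+ n.
  suff : phi y - phi (u n) <= (phi y - phi x0) * 2^-1 ^+ n.
    by have := phi_mono _ _ (uz n); lra.
  elim: n => [|n IH]; first by rewrite expr0 mulr1 u0.
  have := (uS n).2; have := leS (u n) y (le_trans _ _ _ (uz n) zy).
  by rewrite exprS mulrCA; lra.
rewrite -subr_le0.
have : (phi y - phi x0) * 2^-1 ^+ n @[n --> \oo] --> (phi y - phi x0) * 0.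
  by apply: cvgMr; apply: cvg_expr; rewrite ger0_norm ?invr_ge0// invf_lt1 ?ltr1n.
rewrite mulr0 => h; rewrite -(cvg_lim _ h)//.
by apply: limr_ge; [exact: cvgP h|exact: nearW].
Qed.

(** * Length profiles of subsets of the unit interval *)

Fact unit_lebesgue_fin_num (R : realType) : fin_num_fun (@unit_lebesgue R).
Proof.
move=> A mA; rewrite ge0_fin_numE//.
apply: (@le_lt_trans _ _ (lebesgue_measure (@unit_interval_set R))).
  apply: le_measure; rewrite ?inE; first exact: measurable_unit_image.
    exact: measurable_itv.
  by move=> _ [x _ <-]; exact: set_valP.
by rewrite /unit_interval_set lebesgue_measure_itv /= lte_fin ltr01 ltry.
Qed.

HB.instance Definition _ (R : realType) :=
  @Measure_isFinite.Build _ (unit_interval R) R (@unit_lebesgue R)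
    (@unit_lebesgue_fin_num R).

Section profile.
Context {R : realType}.
Implicit Types (A B : set (unit_interval R)) (s t : R).
Local Notation lam := (mass (@unit_lebesgue R)).

Definition below t : set (unit_interval R) := [set x | unit_val x <= t].

Definition between s t : set (unit_interval R) := [set x | s < unit_val x <= t].

Definition profile A t : R := lam (A `&` below t).

Lemma measurable_unit_preimage (B : set R) :
  measurable (B : set (measurableTypeR R)) ->
  measurable (@unit_val R @^-1` B).
Proof. by move=> mB; exists B; rewrite ?setTI. Qed.

Lemma measurable_below t : measurable (below t).
Proof.
rewrite (_ : below t = @unit_val R @^-1` `]-oo, t]).
  by apply: measurable_unit_preimage; exact: measurable_itv.
by apply/seteqP; split => x; rewrite /= in_itv.
Qed.

Lemma measurable_between s t : measurable (between s t).
Proof.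
rewrite (_ : between s t = @unit_val R @^-1` `]s, t]).
  by apply: measurable_unit_preimage; exact: measurable_itv.
by apply/seteqP; split => x; rewrite /= in_itv.
Qed.
Hint Resolve measurable_below measurable_between : core.

Lemma unit_val_itv (x : unit_interval R) : 0 <= unit_val x <= 1.
Proof. by have := set_valP x; rewrite /unit_interval_set /= in_itv. Qed.

Lemma mass_between s t : s <= t -> lam (between s t) <= t - s.
Proof.
move=> st; rewrite -lee_fin -massE// /unit_lebesgue.
have := @lebesgue_measure_itv R `]s, t]; rewrite /= lte_fin.
have -> : (if (s < t)%R then t%:E - s%:E else 0)%E = (t - s)%:E.
  by case: ltP => // ts; rewrite (le_anti (introT andP (conj st ts))) subrr.
move=> <-; apply: le_measure; rewrite ?inE//; first exact: measurable_unit_image.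
by move=> _ [x xst <-]; rewrite /= in_itv.
Qed.

Lemma profileB A s t : measurable A -> s <= t ->
  profile A t - profile A s = lam (A `&` between s t).
Proof.
move=> mA st; rewrite /profile.
have -> : A `&` below t = (A `&` below s) `|` (A `&` between s t).
  apply/seteqP; split => x /=; rewrite /below/between/=.
    by move=> [Ax xt]; have [xs|xs] := leP (unit_val x) s; [left|right].
  by move=> [[Ax xs]|[Ax /andP[]]]; split => //; exact: le_trans st.
rewrite massU; try exact: measurableI; first by lra.
rewrite -subset0 => x [[_ xs] [_ /andP[]]].
by rewrite ltNge xs.
Qed.

(** The source of all continuity below: profiles are nondecreasing and
    1-Lipschitz, whatever the set. *)
Lemma profile_incr A s t : measurable A -> s <= t ->
  0 <= profile A t - profile A s <= t - s.
Proof.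
move=> mA st; rewrite profileB// mass_ge0 /=; apply: le_trans (mass_between st).
by apply: le_mass => //; exact: measurableI.
Qed.

Lemma le_profileB A B s t : measurable A -> measurable B -> A `<=` B -> s <= t ->
  profile A t - profile A s <= profile B t - profile B s.
Proof.
move=> mA mB AB st; rewrite !profileB//; apply: le_mass; try exact: measurableI.
exact: setSI.
Qed.

Lemma profile_ge1 A t : 1 <= t -> profile A t = lam A.
Proof.
move=> t1; rewrite /profile (_ : _ `&` _ = A)//; apply: setIidl => x _.
by have /andP[_ x1] := unit_val_itv x; exact: le_trans t1.
Qed.

Lemma profile_le A t : measurable A -> profile A t <= lam A.
Proof. by move=> mA; apply: le_mass => //; exact: measurableI. Qed.

Lemma profile_ge0 A t : 0 <= profile A t. Proof. exact: mass_ge0. Qed.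

Lemma profile0 A : measurable A -> profile A 0 = 0.
Proof.
move=> mA; have /andP[+ _] := @profile_incr A (-1) 0 mA (lerN10 _).
have: profile A (-1) = 0.
  rewrite /profile (_ : _ `&` _ = set0) ?mass0// -subset0 => x [_].
  by rewrite /below /=; have /andP[x0 _] := unit_val_itv x; lra.
move=> _ _; apply/eqP; rewrite eq_le profile_ge0 andbT /profile.
rewrite -lee_fin -massE; last exact: measurableI.
apply: (@le_trans _ _ (lebesgue_measure [set (0 : R)])); last first.
  by rewrite lebesgue_measure_set1.
apply: le_measure; rewrite ?inE//.
  by apply: measurable_unit_image; exact: measurableI.
move=> _ [x [_ x0] <-] /=; have /andP[x0' _] := unit_val_itv x.
by apply: le_anti; rewrite x0'; rewrite andbT.
Qed.

Lemma profile_setID X A t : measurable A -> measurable X ->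
  profile A t = profile (A `&` X) t + profile (A `\` X) t.
Proof.
move=> mA mX; rewrite /profile (mass_setID _ (measurableI _ _ mA (measurable_below t)) mX).
by congr (lam _ + lam _); rewrite ?setDE -!setIA; congr (_ `&` _); rewrite setIC.
Qed.

Lemma profileU A B t : measurable A -> measurable B -> A `&` B = set0 ->
  profile (A `|` B) t = profile A t + profile B t.
Proof.
move=> mA mB AB; rewrite /profile setIUl massU//; try exact: measurableI.
by rewrite setIACA AB set0I.
Qed.

Lemma profile_lipschitz A s t : measurable A ->
  `|profile A s - profile A t| <= `|s - t|.
Proof.
move=> mA; wlog st : s t / s <= t => [H|].
  have [st|/ltW ts] := leP s t; first exact: H.
  by rewrite distrC [leRHS]distrC; exact: H.
by rewrite ler_norml ler0_norm ?subr_le0//; have := profile_incr mA st; lra.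
Qed.

Lemma profile_continuous A : measurable A -> continuous (profile A).
Proof.
move=> mA t; apply/cvgrPdist_le => e e0; near=> s.
apply: le_trans (profile_lipschitz _ _ mA) _; near: s.
exact: cvgr_dist_le.
Unshelve. all: by end_near. Qed.

(** Absence of atoms in its strong form, from the intermediate value theorem
    for the profile of [A]. *)
Lemma subset_mass A c : measurable A -> 0 <= c <= lam A ->
  exists B, [/\ measurable B, B `<=` A & lam B = c].
Proof.
move=> mA /andP[c0 cA].
have [||t _ tc] := @IVT R (profile A) 0 1 c (@ler01 _).
- by apply: continuous_subspaceT; exact: profile_continuous.
- by rewrite profile0// profile_ge1// min_l ?max_r ?c0 ?(le_trans c0 cA).
- by exists (A `&` below t); split => //; exact: measurableI.
Qed.

End profile.
#[export] Hint Resolve measurable_below measurable_between : core.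

(** * Chopping sets and density points *)

Section density.
Context {R : realType}.
Implicit Types (E F : set (unit_interval R)).
Local Notation lam := (mass (@unit_lebesgue R)).

Lemma unit_lebesgue_atomless : atomless (@unit_lebesgue R).
Proof.
move=> A mA; rewrite -[X in (_ < X)%E]/(unit_lebesgue A) massE// lte_fin => A0.
have [A1 A2] : 0 < lam A / 2 /\ lam A / 2 < lam A by split; lra.
have [|B [mB BA Bc]] := @subset_mass R A (lam A / 2) mA; first by rewrite !ltW.
have lE C : measurable C -> unit_lebesgue C = (lam C)%:E by exact: massE.
by exists B; split; rewrite //= !lE// lte_fin Bc.
Qed.

Lemma equal_mass_subsets E F (e : R) : measurable E -> measurable F ->
  0 < lam E -> 0 < lam F -> 0 < e ->
  exists P Q, [/\ measurable P /\ measurable Q, P `<=` E, Q `<=` F,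
    lam P = lam Q & 0 < lam P <= e].
Proof.
move=> mE mF E0 F0 e0.
pose c := Num.min e (Num.min (lam E) (lam F)).
have [c0 [ce [cE cF]]] : 0 < c /\ c <= e /\ c <= lam E /\ c <= lam F.
  rewrite /c; split; first by rewrite !lt_min e0 E0 F0.
  by rewrite !ge_min !lexx !orbT.
have [|P [mP PE Pc]] := @subset_mass R E c mE; first by rewrite ltW.
have [|Q [mQ QF Qc]] := @subset_mass R F c mF; first by rewrite ltW.
by exists P, Q; split => //; rewrite Pc ?Qc// c0.
Qed.

(** The weak form of density used here: [E] fills more than three quarters of
    the small intervals centred at [x]. *)
Definition full_point E (x : R) : Prop :=
  \forall r \near 0^'+, 3 / 2 * r < profile E (x + r) - profile E (x - r).

(** Almost every point of [E] is a density point of [E] by Lebesgue's theorem,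
    so the density points of [E] meet every non-null subset [F] of [E]. *)
Lemma full_point_exists E F : measurable E -> measurable F -> F `<=` E ->
  0 < lam F -> exists x, F x /\ full_point E (unit_val x).
Proof.
move=> mE mF FE F0; apply: contrapT => noF.
have mE' := measurable_unit_image mE.
have [N [mN N0 sN]] := @lebesgue_density R _ mE'.
have : (unit_lebesgue F <= lebesgue_measure N)%E.
  apply: le_measure; rewrite ?inE//; first exact: measurable_unit_image.
  move=> _ [x Fx <-]; apply: sN => cvgx; apply: noF; exists x; split => //.
  move: cvgx; rewrite /= indicE mem_set/=; last by exists x => //; exact: FE.
  move=> /fine_cvg cvgx.
  have c34 : (3 / 4 : R) < 1 by lra.
  have ratio := cvgr_gt _ cvgx _ c34.
  have {}ratio := ratio (at_right_proper_filter 0).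
  rewrite /full_point; apply: filterS2 (nbhs_right_gt 0) ratio => r r0 /=.
  have xr : unit_val x - r <= unit_val x + r by lra.
  rewrite lebesgue_measure_ball ?ltW// inver mulrn_eq0/= gt_eqF//.
  set m := lebesgue_measure _ => mr.
  have : (m <= (profile E (unit_val x + r) - profile E (unit_val x - r))%:E)%E.
    rewrite profileB// -massE; last exact: measurableI.
    apply: le_measure; rewrite ?inE.
    - by apply: measurableI => //; exact: measurable_ball.
    - by apply: measurable_unit_image; exact: measurableI.
    - move=> _ [[y Ey <-]]; rewrite /ball/= ltr_norml => xyr; exists y => //.
      by split => //; rewrite /between /=; lra.
  have m0 : (0 <= m)%E by exact: measure_ge0.
  move: m m0 mr => [m| |] //= _.
  rewrite ltr_pdivlMr ?mulrn_wgt0// lee_fin => mr mD; apply: lt_le_trans mD.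
  by move: mr; rewrite mulr2n; lra.
by rewrite N0 massE// lee_fin leNgt F0.
Qed.

(** More than half of a symmetric interval around [x] cannot lie on one side of
    [x], so [E] charges both sides. *)
Lemma full_point_left E (x e : R) : measurable E -> full_point E x -> 0 < e ->
  0 < profile E x - profile E (x - e).
Proof.
move=> mE fE e0.
have [r [re r0 fr]] : exists r, [/\ r <= e, 0 < r &
    3 / 2 * r < profile E (x + r) - profile E (x - r)].
  near (0 : R)^'+ => r; exists r; split => //.
    by near: r; exact: nbhs_right_le.
  by near: r; exact: fE.
have := @profile_incr R E x (x + r) mE; have := @profile_incr R E (x - e) (x - r) mE.
by lra.
Unshelve. all: by end_near. Qed.

Lemma full_point_right E (x e : R) : measurable E -> full_point E x -> 0 < e ->
  0 < profile E (x + e) - profile E x.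
Proof.
move=> mE fE e0.
have [r [re r0 fr]] : exists r, [/\ r <= e, 0 < r &
    3 / 2 * r < profile E (x + r) - profile E (x - r)].
  near (0 : R)^'+ => r; exists r; split => //.
    by near: r; exact: nbhs_right_le.
  by near: r; exact: fE.
have := @profile_incr R E (x - r) x mE; have := @profile_incr R E (x + r) (x + e) mE.
by lra.
Unshelve. all: by end_near. Qed.

End density.

(** * Points where a constraint is asymptotically tight *)

Section tight.
Context {R : realType}.
Implicit Types (T : set R) (g : R -> R).

(** The closure-free way to say that the gap [g] vanishes at [v]: for a
    nonnegative [g] continuous on a closed [T] it means that [v] is a zero of [g] in [T]. *)
Definition tight T g (v : R) : Prop :=
  forall e, 0 < e -> exists t, [/\ T t, `|t - v| < e & g t < e].

(** The compactness argument of the proof: before the first tight point the gap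
    is bounded below, uniformly, and even from slightly left of [x].  The point
    is found as the supremum of the [y] up to which such a uniform bound
    holds. *)
Lemma first_tight T g (x z : R) : x <= z -> tight T g z ->
  exists v, [/\ x <= v <= z, tight T g v & forall y, x <= y -> y < v ->
    exists e, 0 < e /\ forall t, T t -> x - e <= t -> t <= y -> e <= g t].
Proof.
move=> xz gz.
pose slack y := exists e, 0 < e /\ forall t, T t -> x - e <= t -> t <= y -> e <= g t.
pose S := [set y | x <= y <= z /\ slack y].
have [[s0 Ss0]|S0] := pselect (S !=set0); last first.
  (* No uniform bound even at [y = x]: then [x] itself is tight. *)
  exists x; split; [by rewrite lexx|move=> e e0|move=> y xy]; last first.
    by rewrite ltNge xy.
  apply: contrapT => no; apply: S0; exists x; split; first by rewrite lexx.
  exists (e / 2); split; first by lra.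
  move=> t Tt xt tx; rewrite leNgt; apply/negP => ge; apply: no; exists t.
  by split => //; [rewrite ltr_norml|]; lra.
have hS : has_sup S by split; [exists s0|exists z => y [/andP[]]].
have vS y : S y -> y <= sup S by move=> Sy; exact: sup_upper_bound.
have vz : sup S <= z by apply: sup_le_ub; [exists s0|move=> y [/andP[]]].
have xv : x <= sup S by case: (Ss0) => /andP[xs0 _] _; apply: le_trans (vS _ Ss0).
exists (sup S); split; first by rewrite xv.
- move=> e e0; apply: contrapT => no.
  have far t : T t -> `|t - sup S| < e -> e <= g t.
    by move=> Tt te; rewrite leNgt; apply/negP => ge; apply: no; exists t.
  have e2 : 0 < e / 2 by lra.
  have [y Sy yv] := sup_adherent e2 hS.
  case: (Sy) => /andP[xy yz] [e' [e'0 ey]].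
  have slack' w : w < sup S + e -> slack w.
    have [me me'] : Num.min e e' <= e /\ Num.min e e' <= e'.
      by rewrite !ge_min !lexx orbT.
    move=> wv; exists (Num.min e e'); split; first by rewrite lt_min e0.
    move=> t Tt xt tw; have [ty|ty] := leP t y.
      by apply: (le_trans me'); apply: ey => //; lra.
    by apply: (le_trans me); apply: far => //; rewrite ltr_norml; lra.
  have [zv|zv] := ltP z (sup S + e).
    (* The bound would reach past [z], which is tight. *)
    have [e1 [e10 e1P]] : slack ((z + (sup S + e)) / 2) by apply: slack'; lra.
    have d0 : 0 < Num.min e1 ((sup S + e - z) / 2) by rewrite lt_min e10; lra.
    have [t [Tt + +]] := gz _ d0.
    rewrite !lt_min ltr_norml => /andP[t1 t2] /andP[t3 _].
    have := e1P t Tt; rewrite ltr_norml in t2; move: t2; lra.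
  have /vS : S (sup S + e / 2) by split; [lra|apply: slack'; lra].
  by lra.
- move=> y xy yv; have d0 : 0 < sup S - y by lra.
  have [w Sw yw] := sup_adherent d0 hS.
  case: (Sw) => _ [e [e0 ew]]; exists e; split => // t Tt xt ty; apply: ew => //.
  by lra.
Qed.
Lemma tight_opp T g v :
  tight T g v -> tight [set t | T (- t)] (fun t => g (- t)) (- v).
Proof.
move=> gv e e0; have [t [Tt tv ge]] := gv e e0.
by exists (- t); rewrite /= opprK -opprD normrN.
Qed.

(** The mirror image of [first_tight] under [t |-> - t]. *)
Lemma last_tight T g (x z : R) : z <= x -> tight T g z ->
  exists w, [/\ z <= w <= x, tight T g w & forall y, y <= x -> w < y ->
    exists e, 0 < e /\ forall t, T t -> y <= t -> t <= x + e -> e <= g t].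
Proof.
move=> zx /tight_opp gz.
have xz : - x <= - z by rewrite lerN2.
have [w [/andP[xw wz] gw wS]] := first_tight xz gz.
exists (- w); split.
- by apply/andP; split; lra.
- move=> e e0; have [t [Tt tw ge]] := gw e e0; exists (- t); split => //.
  by rewrite -opprD normrN.
- move=> y yx wy; have [||e [e0 eg]] := wS (- y); [lra|lra|].
  exists e; split => // t Tt yt tx.
  by have := eg (- t); rewrite /= !opprK; apply => //; lra.
Qed.

End tight.

(** * Exchanges between a base and an independent set *)

Section exchange.
Context {R : realType} (T : set R) (a b : R -> R).
Implicit Types A B P Q : set (unit_interval R).
Local Notation lam := (mass (@unit_lebesgue R)).

Lemma bounded_profile_familyE B : bounded_profile_family T a b B <->
  measurable B /\ forall t, T t -> a t <= profile B t <= b t.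
Proof.
have profileE t : measurable B -> unit_lebesgue (B `&` below t) = (profile B t)%:E.
  by move=> mB; apply: massE; exact: measurableI.
split=> -[mB aBb]; split => // t /aBb.
  by rewrite -/(below t) profileE// !lee_fin.
by rewrite -/(below t) profileE// !lee_fin.
Qed.

(** [B'] is obtained from [B] by adding points of [A] and removing points
    outside [A]. *)
Definition toward A B B' : Prop := A `&` B `<=` B' /\ B' `<=` A `|` B.

(** Along such a chain the part inside [A] increases and the part outside [A]
    decreases, so both converge in length on every initial interval, and the
    constraints pass to the limit. *)
Lemma bounded_profile_family_chain A (u : nat -> set (unit_interval R)) :
  measurable A -> (forall n, bounded_profile_family T a b (u n)) ->
  (forall n, toward A (u n) (u n.+1)) ->
  exists z, bounded_profile_family T a b z /\ forall n, toward A (u n) z.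
Proof.
move=> mA famu tu; have mu n : measurable (u n) by case: (famu n).
pose inA n := A `&` u n; pose outA n := u n `\` A.
have minA n : measurable (inA n) by exact: measurableI.
have moutA n : measurable (outA n) by exact: measurableD.
have mU : measurable (\bigcup_n inA n) by exact: bigcupT_measurable.
have mI : measurable (\bigcap_n outA n) by exact: bigcapT_measurable.
exists ((\bigcup_n inA n) `|` (\bigcap_n outA n)); split; last first.
  move=> n; split => [x Anx|x [[m _ [Ax _]]|/(_ n Logic.I) [ux _]]].
  - by left; exists n.
  - by left.
  - by right.
apply/bounded_profile_familyE; split => [|t Tt]; first exact: measurableU.
have cvgu : profile (u n) t @[n --> \oo] -->
    profile ((\bigcup_n inA n) `|` (\bigcap_n outA n)) t.
  rewrite profileU//; last first.
    by rewrite -subset0 => x [[n _ [Ax _]] /(_ n Logic.I) []].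
  rewrite [X in X @ _ --> _](_ : _ =
      fun n => lam (inA n `&` below t) + lam (outA n `&` below t)); last first.
    by apply/funext => n; rewrite (profile_setID _ (mu n) mA) /inA setIC.
  rewrite /profile setI_bigcupl -bigcapIl; last by exists 0%N.
  apply: cvgD.
    apply: cvg_mass_bigcup => n; first exact: measurableI.
    by apply: setSI => x Anx; split; [case: Anx|exact: (tu n).1].
  apply: cvg_mass_bigcap => n; first exact: measurableI.
  by apply: setSI => x [ux Ax]; split => //; case: ((tu n).2 _ ux).
rewrite -(cvg_lim _ cvgu)//; have cu := cvgP _ cvgu.
have fam n := ((bounded_profile_familyE (u n)).1 (famu n)).2 t Tt.
by apply/andP; split; [apply: limr_ge|apply: limr_le] => //;
  apply: nearW => n; case/andP: (fam n).
Qed.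

(** A base that no move towards [A] makes contain more of [A]. *)
Definition stuck A B : Prop := bounded_profile_family T a b B /\
  forall B', bounded_profile_family T a b B' -> toward A B B' ->
    lam (A `&` B') = lam (A `&` B).

Lemma stuck_exists A B : measurable A -> bounded_profile_family T a b B ->
  exists B', toward A B B' /\ stuck A B'.
Proof.
move=> mA famB.
pose X := {C : set (unit_interval R) | bounded_profile_family T a b C}.
pose le (C D : X) := toward A (sval C) (sval D).
pose phi (C : X) := lam (A `&` sval C).
have mX (C : X) : measurable (A `&` sval C).
  by case: (svalP C) => mC _; exact: measurableI.
have [|||||[B' famB'] [BB' maxB']] := @exhaustion R X le phi (lam A) _ _ _ _ _ (exist _ B famB).
- by move=> C; split => x; [case|right].
- move=> C D E [CD DC] [DE ED]; split => x.
    by move=> ACx; apply: DE; split; [case: ACx|exact: CD].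
  by move=> /ED [Ax|/DC]; [left|].
- move=> C D [CD _]; apply: le_mass => // x ACx; split; [by case: ACx|exact: CD].
- by move=> C; apply: le_mass => // x [].
- move=> u uS; have [||z [famz uz]] :=
    @bounded_profile_family_chain A (fun n => sval (u n)) mA.
  + by move=> n; exact: svalP.
  + exact: uS.
  by exists (exist _ z famz).
exists B'; split => //; split => // C famC BC.
exact: (maxB' (exist _ C famC)).
Qed.

Lemma profile_out P s t u : P `<=` between s t -> u <= s -> profile P u = 0.
Proof.
move=> Pst us; rewrite /profile (_ : _ `&` _ = set0) ?mass0//.
rewrite -subset0 => x [/Pst /andP[sx _] xu].
by move: (lt_le_trans sx xu); rewrite ltNge us.
Qed.

Lemma profile_past P s t u : P `<=` between s t -> t <= u -> profile P u = lam P.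
Proof.
move=> Pst tu; rewrite /profile (_ : _ `&` _ = P)//; apply: setIidl => x.
by move=> /Pst /andP[_ xt]; exact: le_trans tu.
Qed.

(** Replacing [Q] by [P] is a move towards [A] with a positive gain, so it must
    break a constraint. *)
Lemma stuck_no_exchange A B P Q : measurable A -> stuck A B ->
  measurable P -> measurable Q -> P `<=` A `\` B -> Q `<=` B `\` A -> 0 < lam P ->
  ~ (forall t, T t -> a t <= profile B t + profile P t - profile Q t <= b t).
Proof.
move=> mA [famB maxB] mP mQ PAB QBA P0 ok.
have mB : measurable B by case: famB.
have mBQ : measurable (B `\` Q) by exact: measurableD.
have : lam (A `&` ((B `\` Q) `|` P)) = lam (A `&` B).
  apply: maxB; last first.
    split => x; first by move=> [Ax Bx]; left; split => // /QBA [].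
    by move=> [[Bx _]|/PAB [Ax _]]; [right|left].
  apply/bounded_profile_familyE; split => [|t Tt]; first exact: measurableU.
  rewrite profileU//; last first.
    by rewrite -subset0 => x [[Bx _] /PAB []].
  have := ok t Tt; rewrite (profile_setID t mB mQ).
  have -> : B `&` Q = Q by apply: setIidr => x /QBA [].
  by lra.
have -> : A `&` ((B `\` Q) `|` P) = (A `&` B) `|` P.
  apply/seteqP; split => x /=.
    by move=> [Ax [[Bx _]|Px]]; [left|right].
  move=> [[Ax Bx]|Px]; last by split; [case: (PAB _ Px)|right].
  by split => //; left; split => // /QBA [].
rewrite massU//; first by lra.
  exact: measurableI.
by rewrite -subset0 => x [[_ Bx] /PAB []].
Qed.

(** Otherwise a small piece of [B `\` A] in ]x, y] could be exchanged for a
    piece of [A `\` B] of the same length just left of [x]: this changes the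
    profile only on [x - e, y], upwards and by at most [e], which is within the
    available slack. *)
Lemma stuck_right A B (x y e : R) : measurable A -> stuck A B ->
  full_point (A `\` B) x -> x <= y -> 0 < e ->
  (forall t, T t -> x - e <= t -> t <= y -> e <= b t - profile B t) ->
  profile (B `\` A) y = profile (B `\` A) x.
Proof.
move=> mA sB fx xy e0 slack; have [mB famB] := (bounded_profile_familyE B).1 sB.1.
have mAB : measurable (A `\` B) by exact: measurableD.
have mBA : measurable (B `\` A) by exact: measurableD.
have /andP[+ _] := profile_incr mBA xy; rewrite le_eqVlt => /orP[/eqP|Q0]; first by lra.
exfalso.
have P0 := full_point_left mAB fx e0.
have xe : x - e <= x by lra.
rewrite !profileB// in P0 Q0.
have [||P [Q [[mP mQ] PE QE PQ /andP[P1 P2]]]] := equal_mass_subsets _ _ P0 Q0 e0.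
  exact: measurableI. exact: measurableI.
have Pb : P `<=` between (x - e) x by move=> z /PE [].
have Qb : Q `<=` between x y by move=> z /QE [].
apply: (@stuck_no_exchange A B P Q) => //.
- by move=> z /PE [].
- by move=> z /QE [].
move=> t Tt; have := famB t Tt.
have := profile_ge0 P t; have PP := profile_le t mP; have := le_trans PP P2.
have := profile_ge0 Q t; have := profile_le t mQ; rewrite -PQ => QP.
have := le_trans QP P2.
have [tx|tx] := leP t (x - e).
  by rewrite (profile_out Pb)// (profile_out Qb)//; lra.
have [ty|ty] := leP t y; last first.
  by rewrite (profile_past Pb) ?(profile_past Qb)//; lra.
have := slack t Tt (ltW tx) ty.
have [tx'|tx'] := leP t x; first by rewrite (profile_out Qb)//; move=> *; apply/andP; split; lra.
by rewrite (profile_past Pb (ltW tx')); move=> *; apply/andP; split; lra.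
Qed.

(** The symmetric exchange, which lowers the profile on [y, x + e] and uses the
    slack above the lower constraint. *)
Lemma stuck_left A B (x y e : R) : measurable A -> stuck A B ->
  full_point (A `\` B) x -> y <= x -> 0 < e ->
  (forall t, T t -> y <= t -> t <= x + e -> e <= profile B t - a t) ->
  profile (B `\` A) y = profile (B `\` A) x.
Proof.
move=> mA sB fx yx e0 slack; have [mB famB] := (bounded_profile_familyE B).1 sB.1.
have mAB : measurable (A `\` B) by exact: measurableD.
have mBA : measurable (B `\` A) by exact: measurableD.
have /andP[+ _] := profile_incr mBA yx; rewrite le_eqVlt => /orP[/eqP|Q0]; first by lra.
exfalso.
have P0 := full_point_right mAB fx e0.
have xe : x <= x + e by lra.
rewrite !profileB// in P0 Q0.
have [||P [Q [[mP mQ] PE QE PQ /andP[P1 P2]]]] := equal_mass_subsets _ _ P0 Q0 e0.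
  exact: measurableI. exact: measurableI.
have Pb : P `<=` between x (x + e) by move=> z /PE [].
have Qb : Q `<=` between y x by move=> z /QE [].
apply: (@stuck_no_exchange A B P Q) => //.
- by move=> z /PE [].
- by move=> z /QE [].
move=> t Tt; have := famB t Tt.
have := profile_ge0 P t; have PP := profile_le t mP; have := le_trans PP P2.
have := profile_ge0 Q t; have := profile_le t mQ; rewrite -PQ => QP.
have := le_trans QP P2.
have [ty|ty] := leP t y.
  by rewrite (profile_out Qb)// (profile_out Pb)//; lra.
have [tx|tx] := leP t (x + e); last first.
  by rewrite (profile_past Pb) ?(profile_past Qb)//; lra.
have := slack t Tt (ltW ty) tx.
have [tx'|tx'] := leP t x; first by rewrite (profile_out Pb)//; move=> *; apply/andP; split; lra.
by rewrite (profile_past Qb (ltW tx')); move=> *; apply/andP; split; lra.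
Qed.

End exchange.

(** * Extending an independent set to a base *)

Section independence.
Context {R : realType} (T : set R) (a b : R -> R).
Implicit Types A B C X : set (unit_interval R).
Local Notation lam := (mass (@unit_lebesgue R)).
Local Notation base := (bounded_profile_family T a b).

(** The explicit form of being contained in a base. *)
Definition independent : set (set (unit_interval R)) :=
  [set A | measurable A /\ forall s t, T s -> T t -> s <= t ->
    profile A t - profile A s <= b t - a s].

Lemma independent_ae_subset A B : measurable A ->
  ae_subset (@unit_lebesgue R) A B -> independent B -> independent A.
Proof.
move=> mA AB [mB iB]; split => // s t Ts Tt st; apply: le_trans (iB s t Ts Tt st).
rewrite !profileB//; apply: le_mass_ae; [exact: measurableI..|].
exact: ae_subsetSI.
Qed.

Lemma base_independent B : base B -> independent B.
Proof.
move=> /bounded_profile_familyE [mB aBb]; split => // s t /aBb + /aBb + st.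
by lra.
Qed.

(** Where the independence of [A] enters: if the profile of [B] touches [a] at
    [w] and [b] at [v], the bound on the growth of [A] is the growth of [B]. *)
Lemma tight_increment A B w v : independent A -> measurable B ->
  tight T (fun t => profile B t - a t) w -> tight T (fun t => b t - profile B t) v ->
  w < v -> profile A v - profile A w <= profile B v - profile B w.
Proof.
move=> [mA iA] mB tw tv wv; apply/ler_addgt0Pr => e e0.
(* Two errors from tightness and four from moving the profiles of [A] and [B]
   to the nearby points of [T], each below [c]; the second term of the minimum
   keeps these points in order. *)
pose c := Num.min (e / 6) ((v - w) / 2).
have c0 : 0 < c by rewrite lt_min; apply/andP; split; lra.
have [ce cvw] : c <= e / 6 /\ c <= (v - w) / 2 by rewrite !ge_min !lexx orbT.
have [t [Tt tv' bt]] := tv c c0; have [s [Ts sw sa]] := tw c c0.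
have := le_lt_trans (profile_lipschitz t v mA) tv'.
have := le_lt_trans (profile_lipschitz t v mB) tv'.
have := le_lt_trans (profile_lipschitz s w mA) sw.
have := le_lt_trans (profile_lipschitz s w mB) sw.
move: tv' sw; rewrite !ltr_norml => tv' sw.
have st : s <= t by lra.
by have := iA s t Ts Tt st; lra.
Qed.

Hypothesis T0 : T 0.
Hypothesis T1 : T 1.
Hypothesis a0 : a 0 = 0.
Hypothesis ab1 : a 1 = b 1.

(** If the nearest touching points [w <= x <= v] differ, [B `\` A] is null
    between them while [A `\` B] is not, against [tight_increment]. *)
Lemma full_point_tight A B x : independent A -> stuck T a b A B -> 0 <= x <= 1 ->
  full_point (A `\` B) x ->
  tight T (fun t => profile B t - a t) x /\ tight T (fun t => b t - profile B t) x.
Proof.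
move=> iA sB /andP[x0 x1] fx; have mA := iA.1.
have [mB aBb] := (bounded_profile_familyE T a b B).1 sB.1.
have mAB : measurable (A `\` B) by exact: measurableD.
have mBA : measurable (B `\` A) by exact: measurableD.
have t0 : tight T (fun t => profile B t - a t) 0.
  by move=> e e0; exists 0; rewrite subrr normr0 profile0// a0 subrr.
have t1 : tight T (fun t => b t - profile B t) 1.
  move=> e e0; exists 1; rewrite subrr normr0; split => //.
  by have := aBb 1 T1; rewrite ab1; lra.
have [v [/andP[xv v1] tv vS]] := first_tight x1 t1.
have [w [/andP[w0 wx] tw wS]] := last_tight x0 t0.
have [wv|vw] := ltP w v; last first.
  have wE : w = x by apply: le_anti; rewrite wx (le_trans xv vw).
  have vE : v = x by apply: le_anti; rewrite xv (le_trans vw wx).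
  by rewrite -{1}wE -vE.
exfalso.
have Bv : profile (B `\` A) v <= profile (B `\` A) x.
  apply/ler_addgt0Pr => e e0; have [xv'|vx] := ltP x v; last first.
    by rewrite (le_anti (introT andP (conj vx xv))); lra.
  pose y := Num.max x (v - e).
  have xy : x <= y by rewrite le_max lexx.
  have yv : y < v by rewrite gt_max xv' /=; lra.
  have vy : v - e <= y by rewrite le_max lexx orbT.
  have [e' [e'0 eS]] := vS y xy yv.
  have := stuck_right mA sB fx xy e'0 eS.
  by have := profile_incr mBA (ltW yv); lra.
have Bw : profile (B `\` A) x <= profile (B `\` A) w.
  apply/ler_addgt0Pr => e e0; have [xw'|wx'] := ltP w x; last first.
    by rewrite (le_anti (introT andP (conj wx wx'))); lra.
  pose y := Num.min x (w + e).
  have xy : y <= x by rewrite ge_min lexx.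
  have yw : w < y by rewrite lt_min xw' /=; lra.
  have wy : y <= w + e by rewrite ge_min lexx orbT.
  have [e' [e'0 eS]] := wS y xy yw.
  have := stuck_left mA sB fx xy e'0 eS.
  by have := profile_incr mBA (ltW yw); lra.
have := tight_increment iA mB tw tv wv.
rewrite !(profile_setID _ mA mB) !(profile_setID _ mB mA) (setIC B A).
have [xv'|vx] := ltP x v.
  have e0 : 0 < v - x by lra.
  have := full_point_right mAB fx e0; have -> : x + (v - x) = v by ring.
  by have := profile_incr mAB wx; lra.
have wx' : w < x by lra.
have e0 : 0 < x - w by lra.
have := full_point_left mAB fx e0; have -> : x - (x - w) = w by ring.
by have := profile_incr mAB xv; lra.
Qed.

(** A density point sees more than three quarters of a small interval
    ]x - r, x + r] filled by [A `\` B].  Density points [s] and [t] chosen in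
    its first and last quarters satisfy t - s > r, so [A `\` B], which misses
    less than r / 2, fills more than half of ]s, t]; but there
    [tight_increment] makes [B `\` A] at least as long, and the two sets are
    disjoint. *)
Lemma stuck_ae_subset A B : independent A -> stuck T a b A B ->
  ae_subset (@unit_lebesgue R) A B.
Proof.
move=> iA sB; have mA := iA.1; have mB : measurable B by case: sB.1.
have mAB : measurable (A `\` B) by exact: measurableD.
have mBA : measurable (B `\` A) by exact: measurableD.
apply/mass_ae_subset => //; apply: contrapT => /eqP AB0.
have {}AB0 : 0 < lam (A `\` B) by rewrite lt_neqAle eq_sym AB0 mass_ge0.
have [x [_ fx]] := full_point_exists mAB mAB (@subset_refl _ _) AB0.
have [r [r0 fr]] : exists r, 0 < r /\ 3 / 2 * r <
    profile (A `\` B) (unit_val x + r) - profile (A `\` B) (unit_val x - r).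
  by near (0 : R)^'+ => r; exists r; split => //; near: r; exact: fx.
move: (unit_val x) fr => {fx} {}x fr.
have tightP y z : y <= z -> z - y = r / 2 -> x - r <= y -> z <= x + r ->
    exists u, [/\ y < u <= z, 
      tight T (fun t => profile B t - a t) u & tight T (fun t => b t - profile B t) u].
  move=> yz zy xy zx.
  have posF : 0 < lam ((A `\` B) `&` between y z).
    rewrite -profileB//.
    have := profile_incr mAB xy; have := profile_incr mAB zx.
    by lra.
  have mF : measurable ((A `\` B) `&` between y z) by exact: measurableI.
  have [u [[_ uyz] fu]] := full_point_exists mAB mF (@subIsetl _ _ _) posF.
  have [] := full_point_tight iA sB (unit_val_itv u) fu.
  by exists (unit_val u).
have [||||s [/andP[s1 s2] ts _]] := tightP (x - r) (x - r / 2); [lra..|].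
have [||||t [/andP[t1 t2] _ tt]] := tightP (x + r / 2) (x + r); [lra..|].
have st : s < t by lra.
have := tight_increment iA mB ts tt st.
rewrite !(profile_setID _ mA mB) !(profile_setID _ mB mA) (setIC B A).
have AB_BA : (A `\` B) `&` (B `\` A) = set0.
  by rewrite -subset0 => z [[_ ?] []].
have := profile_incr (measurableU _ _ mAB mBA) (ltW st).
rewrite !profileU//.
have xs : x - r <= s by lra.
have tx : t <= x + r by lra.
have := profile_incr mAB xs; have := profile_incr mAB tx.
lra.
Unshelve. all: by end_near. Qed.

(** The exchange property that carries the matroid axioms. *)
Lemma base_extension A B : independent A -> base B ->
  exists B', [/\ base B', ae_subset (@unit_lebesgue R) A B' & B' `<=` A `|` B].
Proof.
move=> iA bB; have [B' [[_ B'AB] sB']] := stuck_exists iA.1 bB.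
by exists B'; split => //; [exact: sB'.1|exact: stuck_ae_subset].
Qed.

End independence.

(** * The matroid *)

Section matroid.
Context {R : realType} (T : set R) (a b : R -> R).
Implicit Types A B C X : set (unit_interval R).
Local Notation lam := (mass (@unit_lebesgue R)).
Local Notation base := (bounded_profile_family T a b).
Local Notation indep := (independent T a b).

Hypothesis T0 : T 0.
Hypothesis T1 : T 1.
Hypothesis a0 : a 0 = 0.
Hypothesis ab1 : a 1 = b 1.

Lemma base_mass B : base B -> lam B = b 1.
Proof.
move=> /bounded_profile_familyE [mB /(_ 1 T1)]; rewrite profile_ge1// ab1 => Bb.
by apply: le_anti; rewrite andbC.
Qed.

Lemma independent_mass A : indep A -> lam A <= b 1.
Proof.
move=> [mA /(_ 0 1 T0 T1 (@ler01 _))].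
by rewrite profile_ge1// profile0// a0 !subr0.
Qed.

(** Extending [A2] first and [A1] inside [A1 `|` B2] afterwards makes the part of
    [B1] outside [X] a part of [B2]; bases have equal length, so the parts
    inside [X] compare the other way. *)
Lemma maximal_independent_mass_le B0 X A1 A2 : base B0 -> measurable X ->
  maximal_sets (@unit_lebesgue R) (family_below (@unit_lebesgue R) indep X) A1 ->
  family_below (@unit_lebesgue R) indep X A2 -> lam A2 <= lam A1.
Proof.
move=> bB0 mX [[iA1 A1X] maxA1] [iA2 A2X].
have [B2 [bB2 A2B2 _]] := base_extension T0 T1 a0 ab1 iA2 bB0.
have [B1 [bB1 A1B1 B1AB]] := base_extension T0 T1 a0 ab1 iA1 bB2.
have [mA1 _] := iA1; have [mA2 _] := iA2.
have [mB1 _] := bB1; have [mB2 _] := bB2.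
have mB1X : measurable (B1 `&` X) by exact: measurableI.
have mB2X : measurable (B2 `&` X) by exact: measurableI.
have B1XA1 : ae_subset (@unit_lebesgue R) (B1 `&` X) A1.
  apply: maxA1; last exact: ae_subsetI.
  split; last by apply: subset_ae_subset => x [].
  apply: independent_ae_subset (base_independent bB1) => //.
  by apply: subset_ae_subset => x [].
have B1X : lam (B1 `&` X) <= lam A1 by exact: le_mass_ae.
have A2le : lam A2 <= lam (B2 `&` X).
  by apply: le_mass_ae => //; exact: ae_subsetI.
have mA1X : measurable (A1 `\` X) by exact: measurableD.
have B1B2 : lam (B1 `\` X) <= lam (B2 `\` X).
  have mB2X' : measurable (B2 `\` X) by exact: measurableD.
  have mB1X' : measurable (B1 `\` X) by exact: measurableD.
  apply: le_mass_ae => //; apply: (@ae_subset_trans _ _ _ _ _ ((A1 `\` X) `|` (B2 `\` X))).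
  - by [].
  - exact: measurableU.
  - by [].
  - by apply: subset_ae_subset => x [/B1AB [?|?] ?]; [left|right].
  rewrite /ae_subset setDUl [X in _ `|` X](_ : _ = set0) ?setU0; last first.
    by rewrite -subset0 => x [].
  apply/(mass_ae_subset _ mA1X mB2X'); apply: le_anti; rewrite mass_ge0 andbT.
  rewrite -((mass_ae_subset _ mA1 mX).1 A1X); apply: le_mass => //.
  exact: measurableD.
apply: le_trans (le_trans A2le _) B1X.
rewrite -(lerD2r (lam (B2 `\` X))) -mass_setID// (base_mass bB2) -(base_mass bB1).
by rewrite (mass_setID _ mB1 mX) lerD2l.
Qed.

(** The sequence increases only up to null sets; its finite unions increase
    genuinely and differ from its terms by null sets. *)
Lemma independent_bigcup (E : (set (unit_interval R))^nat) :
  (forall n, indep (E n)) ->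
  (forall n, ae_subset (@unit_lebesgue R) (E n) (E n.+1)) ->
  indep (\bigcup_n E n).
Proof.
move=> iE ndE; have mE n : measurable (E n) by case: (iE n).
pose U n := \big[setU/set0]_(i < n.+1) E i.
have mU n : measurable (U n) by exact: bigsetU_measurable.
have UE n : ae_subset (@unit_lebesgue R) (U n) (E n).
  elim: n => [|n IH]; first by rewrite /U big_ord1; exact: subset_ae_subset.
  have UEn := ae_subset_trans (mU n) (mE n) (mE n.+1) IH (ndE n).
  by rewrite /U big_ord_recr -/(U n) /ae_subset setDUl setDv setU0.
have mUE : measurable (\bigcup_n E n) by exact: bigcupT_measurable.
have cvgU t : profile (U n) t @[n --> \oo] --> profile (\bigcup_n E n) t.
  rewrite -bigcup_bigsetU_bigcup /profile setI_bigcupl.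
  apply: cvg_mass_bigcup => n; first exact: measurableI.
  by apply: setSI; rewrite /U [X in _ `<=` X]big_ord_recr; exact: subsetUl.
split => // s t Ts Tt st.
have cvgUst : profile (U n) t - profile (U n) s @[n --> \oo] -->
    profile (\bigcup_n E n) t - profile (\bigcup_n E n) s.
  exact: cvgB (cvgU t) (cvgU s).
rewrite -(cvg_lim _ cvgUst)//; apply: limr_le; first exact: cvgP cvgUst.
apply: nearW => n; have [_] := independent_ae_subset (mU n) (UE n) (iE n).
exact.
Qed.

Lemma bases_independent B0 : base B0 -> bases (@unit_lebesgue R) indep = base.
Proof.
move=> bB0; apply/seteqP; split => [A [iA maxA]|B bB].
  have [B [bB AB _]] := base_extension T0 T1 a0 ab1 iA bB0.
  have BA := maxA B (base_independent bB) AB.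
  have mA := iA.1; have [mB aBb] := (bounded_profile_familyE T a b B).1 bB.
  apply/bounded_profile_familyE; split => // t /aBb.
  suff -> : profile A t = profile B t by [].
  apply: le_anti; rewrite /profile !le_mass_ae//; try exact: measurableI.
    exact: ae_subsetSI.
  exact: ae_subsetSI.
split => [|A iA BA]; first exact: base_independent.
have mA := iA.1; have [mB _] := bB.
apply/mass_ae_subset => //; apply: le_anti; rewrite mass_ge0 andbT.
have BAle : lam B <= lam (A `&` B).
  by apply: le_mass_ae => //; [exact: measurableI|apply: ae_subsetI => //; exact: subset_ae_subset].
rewrite -(lerD2l (lam (A `&` B))) addr0 -mass_setID//.
by apply: le_trans (independent_mass iA) _; rewrite -(base_mass bB).
Qed.

Lemma independent_matroid B0 : base B0 ->
  measurable_matroid (@unit_lebesgue R) indep.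
Proof.
move=> bB0; split.
- exact: unit_interval_standard_borel.
- by rewrite -ge0_fin_numE//; exact: unit_lebesgue_fin_num.
- exact: unit_lebesgue_atomless.
- split => [A []//|A B iA mB AB]; have mA := iA.1.
  apply: independent_ae_subset iA => //; apply: (subset_measure0 _ _ _ AB).
  + exact: measurableD.
  + by apply: measurableU; exact: measurableD.
  + by move=> x BAx; right.
- split => // s t Ts Tt st; rewrite /profile !set0I !mass0 subrr.
  have [mB0 fB0] := (bounded_profile_familyE T a b B0).1 bB0.
  have := fB0 s Ts; have := fB0 t Tt; have := profile_incr mB0 st.
  by lra.
- move=> A B mA AB iB; exact: independent_ae_subset iB.
- move=> X mX A B maxA maxB; have mA := maxA.1.1.1; have mB := maxB.1.1.1.
  have lE C : measurable C -> unit_lebesgue C = (lam C)%:E by exact: massE.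
  rewrite -[LHS]/(unit_lebesgue A) -[RHS]/(unit_lebesgue B) !lE//.
  congr (_%:E); apply: le_anti; apply/andP; split.
    exact: (maximal_independent_mass_le bB0 mX maxB maxA.1).
  exact: (maximal_independent_mass_le bB0 mX maxA maxB.1).
- exact: independent_bigcup.
Qed.

End matroid.

Theorem theorem3p13 (R : realType) (T : set R) (r : R) (a b : R -> R)
  (T_sub : T `<=` `[0, 1]) (T0 : T 0) (T1 : T 1)
  (r_ge0 : 0 <= r) (r_le1 : r <= 1)
  (a_range : forall t, T t -> 0 <= a t <= r)
  (b_range : forall t, T t -> 0 <= b t <= r)
  (a0 : a 0 = 0) (b0 : b 0 = 0) (a1 : a 1 = r) (b1 : b 1 = r)
  (a_le_b : forall t, T t -> a t <= b t)
  (a_lip : forall s t, T s -> T t -> s <= t -> 0 <= a t - a s <= t - s)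
  (b_lip : forall s t, T s -> T t -> s <= t -> 0 <= b t - b s <= t - s)
  (nonempty : bounded_profile_family T a b !=set0) :
  exists F : set (set (unit_interval R)),
    measurable_matroid (@unit_lebesgue R) F /\
    bases (@unit_lebesgue R) F = bounded_profile_family T a b.
Proof.
have [B bB] := nonempty; have ab1 : a 1 = b 1 by rewrite a1 b1.
exists (independent T a b); split; first exact: independent_matroid bB.
exact: bases_independent bB.
Qed.
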